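(* There is an absolute constant $K>0$ such that the following holds. Let $d\ge1$, $N\ge2$, let $\alpha_1,\dots,\alpha_d$ be real numbers, and let $w_n=(\alpha_1 n,\dots,\alpha_d n)\in(\mathbb{R}/\mathbb{Z})^d$. For each $i\in\{1,\dots,N\}$ choose $j=j(i)\in\{1,\dots,N\}$ with $j\ne i$ such that $\|w_i-w_j\|$ is minimal. Then the set $D=\{\pm(w_i-w_{j(i)}): i=1,\dots,N\}$ has at most $K(4/3)^d$ distinct elements.
   Context: For $t=(t_1,\dots,t_d)\in(\mathbb{R}/\mathbb{Z})^d$, $\|t\|=\min_{n\in\mathbb{Z}^d}|t-n|=\left(\sum_{i=1}^d\min_{n_i\in\mathbb{Z}}|t_i-n_i|^2\right)^{1/2}$, and the distance between $x,y$ is $\|x-y\|$. *)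

(* Defs.v *)
From HB Require Import structures.
From mathcomp Require Import all_boot all_order all_algebra.
From mathcomp Require Import reals Rstruct.
Set Implicit Arguments. Unset Strict Implicit. Unset Printing Implicit Defensive.
Import Order.TTheory GRing.Theory Num.Theory.
Local Open Scope ring_scope.

Notation R := Rdefinitions.R.

Definition distZ (x : R) : R :=
  Num.min (x - (Num.floor x)%:~R) ((Num.floor x)%:~R + 1 - x).

(* Torus norm of t in (R/Z)^d, t given by any real representative:
   ||t|| = (sum_i min_{n_i in Z} |t_i - n_i|^2)^(1/2). *)
Definition tnorm (d : nat) (t : 'I_d -> R) : R :=
  Num.sqrt (\sum_(i < d) (distZ (t i)) ^+ 2).

(* Canonical representative in [0,1)^d of a point of (R/Z)^d:
   two real vectors define the same torus point iff their reps coincide. *)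
Definition trep (d : nat) (t : 'I_d -> R) : 'rV[R]_d :=
  \row_(k < d) (t k - (Num.floor (t k))%:~R).

Definition w (d : nat) (alpha : 'I_d -> R) (n : nat) : 'I_d -> R :=
  fun k => alpha k * n%:R.

Definition wdiff (d : nat) (alpha : 'I_d -> R) (a b : nat) : 'I_d -> R :=
  fun k => w alpha a k - w alpha b k.

Definition Dlist (d : nat) (alpha : 'I_d -> R) (j : nat -> nat) (N : nat)
  : seq 'rV[R]_d :=
  [seq trep (wdiff alpha i (j i)) | i <- iota 1 N] ++
  [seq trep (wdiff alpha (j i) i) | i <- iota 1 N].

Definition cardD (d : nat) (alpha : 'I_d -> R) (j : nat -> nat) (N : nat) : nat :=
  size (undup (Dlist alpha j N)).

(* Main.v *)
(* The difference at i is +-w_n, where n = |i - j(i)| minimises ||w_m|| over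
   1 <= m <= max(i - 1, N - i).  Split these n at N/2.  Within each half, two
   values m < n satisfy n - m <= max(m, N/2), so the shortest lifts u, v of w_n, w_m
   have |u - v| >= max(|u|, |v|): the nonzero ones make pairwise angles of at
   least 60 degrees.

   Such spherical codes are bounded as by Kabatiansky and Levenshtein.  Pad the
   dimension to 25q and let P_i be the monic Gegenbauer polynomials; the matrices
   P_i(<x_a, x_b>) are Gram matrices, of zonal harmonics for the Fischer product on
   polynomials.  A suitable nonnegative combination K of the P_i with
   2q < i < 2q + 100 has the property that (t - l) K(t) has nonnegative coefficients
   on the P_i for some l > 1/2.  By Schur's product theorem, summing over the code,
   sum (t - 1/2) K^2 >= (l - 1/2) sum K^2 >= (l - 1/2) (tr K)^2 / D, where D is the
   number of features; off the diagonal the left-hand terms are nonpositive, so the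
   code has O(D) points, and the binomial bound on D gives (4/3)^(25q). *)
Require Import Defs.
From HB Require Import structures.
From mathcomp Require Import all_boot all_order all_algebra.
From mathcomp Require Import reals Rstruct.
From mathcomp Require Import mpoly ring lra zify.
Set Implicit Arguments. Unset Strict Implicit. Unset Printing Implicit Defensive.
Import Order.TTheory GRing.Theory Num.Theory.
Local Open Scope ring_scope.

(** * Zonal harmonics and Gegenbauer polynomials *)

Section Zonal.
Variables (F : realFieldType) (n : nat).
Implicit Types (x y : 'I_n -> F) (p q : {mpoly F[n]}).

Definition dotp x y : F := \sum_(i < n) x i * y i.
Definition linform x : {mpoly F[n]} := \sum_(i < n) x i *: 'X_i.
Definition sqnorm : {mpoly F[n]} := \sum_(i < n) 'X_i ^+ 2.
Definition dirder x p := \sum_(i < n) x i *: p^`M(i).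
Definition euler p := \sum_(i < n) 'X_i * p^`M(i).
Definition laplacian p := \sum_(i < n) p^`M(i)^`M(i).

Lemma mderiv_var (i j : 'I_n) : ('X_j : {mpoly F[n]})^`M(i) = (i == j)%:R.
Proof.
rewrite mderivX mnm1E eq_sym; case: eqVneq => [->|_]; last by rewrite scale0r.
suff -> : (U_(j) - U_(j) = 0 :> 'X_{1..n})%MM by rewrite scale1r mpolyX0.
by apply/mnmP => k; rewrite mnmBE subnn mnm0E.
Qed.

Lemma mderiv_linform x i : (linform x)^`M(i) = (x i)%:MP.
Proof.
rewrite /linform raddf_sum (bigD1 i) //= mderivZ mderiv_var eqxx big1 ?addr0.
  by rewrite alg_mpolyC.
by move=> j ji; rewrite mderivZ mderiv_var eq_sym (negbTE ji) scaler0.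
Qed.

Lemma mderiv_sqnorm i : sqnorm^`M(i) = 2 *: 'X_i.
Proof.
rewrite /sqnorm raddf_sum (bigD1 i) //= expr2 mderivM mderiv_var eqxx big1.
  by rewrite mul1r mulr1 addr0 scaler_nat mulr2n.
by move=> j ji; rewrite expr2 mderivM mderiv_var eq_sym (negbTE ji) mul0r mulr0 addr0.
Qed.

Lemma dirderM x p q : dirder x (p * q) = dirder x p * q + p * dirder x q.
Proof.
rewrite /dirder mulr_suml mulr_sumr -big_split; apply: eq_bigr => i _ /=.
by rewrite mderivM scalerDr scalerAl scalerAr.
Qed.

Lemma dirderB x p q : dirder x (p - q) = dirder x p - dirder x q.
Proof.
by rewrite /dirder -sumrB; apply: eq_bigr => i _; rewrite mderivB scalerBr.
Qed.

Lemma dirderZ x c p : dirder x (c *: p) = c *: dirder x p.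
Proof.
rewrite /dirder scaler_sumr; apply: eq_bigr => i _.
by rewrite mderivZ !scalerA mulrC.
Qed.

Lemma dirder_linform x y : dirder x (linform y) = (dotp x y)%:MP.
Proof.
rewrite /dirder /dotp raddf_sum; apply: eq_bigr => i _ /=.
by rewrite mderiv_linform -mul_mpolyC -mpolyCM.
Qed.

Lemma dirder_sqnorm x : dirder x sqnorm = 2 *: linform x.
Proof.
rewrite /dirder /linform scaler_sumr; apply: eq_bigr => i _ /=.
by rewrite mderiv_sqnorm !scalerA mulrC.
Qed.

Lemma eulerM p q : euler (p * q) = euler p * q + p * euler q.
Proof.
rewrite /euler mulr_suml mulr_sumr -big_split; apply: eq_bigr => i _ /=.
by rewrite mderivM mulrDr; congr (_ + _); [exact: mulrA | exact: mulrCA].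
Qed.

Lemma eulerB p q : euler (p - q) = euler p - euler q.
Proof.
by rewrite /euler -sumrB; apply: eq_bigr => i _; rewrite mderivB mulrBr.
Qed.

Lemma eulerZ c p : euler (c *: p) = c *: euler p.
Proof.
by rewrite /euler scaler_sumr; apply: eq_bigr => i _; rewrite mderivZ -scalerAr.
Qed.

Lemma euler_linform x : euler (linform x) = linform x.
Proof.
rewrite /euler /linform; apply: eq_bigr => i _ /=.
by rewrite mderiv_linform mulrC mul_mpolyC.
Qed.

Lemma euler_sqnorm : euler sqnorm = 2 *: sqnorm.
Proof.
rewrite /euler {2}/sqnorm scaler_sumr; apply: eq_bigr => i _ /=.
by rewrite mderiv_sqnorm -scalerAr.
Qed.

Lemma laplacianB p q : laplacian (p - q) = laplacian p - laplacian q.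
Proof. by rewrite /laplacian -sumrB; apply: eq_bigr => i _; rewrite !mderivB. Qed.

Lemma laplacianZ c p : laplacian (c *: p) = c *: laplacian p.
Proof.
by rewrite /laplacian scaler_sumr; apply: eq_bigr => i _; rewrite !mderivZ.
Qed.

Lemma laplacian_linform x p :
  laplacian (linform x * p) = 2 *: dirder x p + linform x * laplacian p.
Proof.
rewrite /laplacian /dirder scaler_sumr mulr_sumr -big_split.
apply: eq_bigr => i _ /=.
rewrite mderivM mderiv_linform mderivD !mderivM mderivC mul0r add0r.
by rewrite mderiv_linform addrA mul_mpolyC -mulr2n scaler_nat.
Qed.

Lemma laplacian_sqnorm p :
  laplacian (sqnorm * p) =
    (2 * n%:R) *: p + 4 *: euler p + sqnorm * laplacian p.
Proof.
rewrite /laplacian /euler scaler_sumr mulr_sumr.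
have -> : (2 * n%:R) *: p = \sum_(i < n) 2 *: p.
  by rewrite sumr_const card_ord -scaler_nat scalerA mulrC.
rewrite -!big_split; apply: eq_bigr => i _ /=.
rewrite mderivM mderiv_sqnorm mderivD !mderivM mderivZ mderiv_var eqxx.
rewrite mderiv_sqnorm -!scalerAl mul1r addrA; congr (_ + _).
by rewrite -addrA -scalerDl -natrD.
Qed.

(** For Z_i = [zonal x i] with unit pole x, the derivative of Z_i along x is [pole_coef i] times
    Z_(i-1); [rec_coef] is the three-term recurrence coefficient of the monic Gegenbauer polynomials
    of parameter (n - 2) / 2. *)
Definition pole_coef (i : nat) : F :=
  i%:R * (i%:R + n%:R - 3) / (2 * i%:R + n%:R - 4).
Definition rec_coef (i : nat) : F := pole_coef i / (2 * i%:R + n%:R - 2).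

(* [zonal x i] is the monic zonal harmonic with pole [x] when [dotp x x = 1]. *)
Fixpoint zonal x (i : nat) : {mpoly F[n]} :=
  match i with
  | 0 => 1
  | i'.+1 => linform x * zonal x i' -
      (if i' is i''.+1 then rec_coef i' *: (sqnorm * zonal x i'') else 0)
  end.

Fixpoint gegen (i : nat) (t : F) : F :=
  match i with
  | 0 => 1
  | i'.+1 => t * gegen i' t - (if i' is i''.+1 then rec_coef i' * gegen i'' t else 0)
  end.

Lemma zonal1 x : zonal x 1 = linform x.
Proof. by rewrite /= mulr1 subr0. Qed.

Lemma zonalSS x i : zonal x i.+2 =
  linform x * zonal x i.+1 - rec_coef i.+1 *: (sqnorm * zonal x i).
Proof. by []. Qed.

Lemma gegenSS i t : gegen i.+2 t = t * gegen i.+1 t - rec_coef i.+1 * gegen i t.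
Proof. by []. Qed.

Lemma euler_zonal x i : euler (zonal x i) = i%:R *: zonal x i.
Proof.
suff: euler (zonal x i) = i%:R *: zonal x i /\
      euler (zonal x i.+1) = i.+1%:R *: zonal x i.+1 by case.
elim: i => [|i [IH0 IH1]].
  rewrite zonal1 euler_linform scale1r scale0r; split=> //.
  by rewrite /euler big1 // => i _ /=; rewrite -mpolyC1 mderivC mulr0.
split=> //; rewrite zonalSS eulerB eulerZ !eulerM euler_linform euler_sqnorm.
rewrite IH0 IH1 -!scalerAl -!scalerAr scalerBr -{1}[_ * zonal x i.+1]scale1r.
rewrite -!scalerDl !scalerA -!natrD.
by rewrite [1 + _]addrC natr1 [rec_coef _ * _]mulrC.
Qed.

Hypothesis n_ge3 : (3 <= n)%N.

Lemma rec_coef_den i : 2 * i.+1%:R + n%:R - 2 != 0 :> F.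
Proof. rewrite -!natrM -natrD -natrB ?pnatr_eq0; lia. Qed.

Lemma pole_coef_den i : 2 * i.+1%:R + n%:R - 4 != 0 :> F.
Proof. rewrite -!natrM -natrD -natrB ?pnatr_eq0; lia. Qed.

(** Induction on two consecutive cases: differentiate the recurrence along the pole and insert both
    hypotheses. The coefficients then match by the identities [pole_coefS] and [pole_rec_coef]. *)
Lemma dirder_zonal x i : dotp x x = 1 ->
  dirder x (zonal x i.+1) = pole_coef i.+1 *: zonal x i.
Proof.
move=> xx.
suff: dirder x (zonal x i.+1) = pole_coef i.+1 *: zonal x i /\
      dirder x (zonal x i.+2) = pole_coef i.+2 *: zonal x i.+1 by case.
have D1 : dirder x (zonal x 1) = pole_coef 1 *: zonal x 0.
  rewrite zonal1 dirder_linform xx /= /pole_coef alg_mpolyC; congr _%:MP.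
  by have := pole_coef_den 0; move=> H; field; move: H; congr (_ != _); ring.
(* Used with p = [linform x * zonal x i.+1] and q = [sqnorm * zonal x i], so that p - b1 q is
   [zonal x i.+2]. *)
have alg (p q : {mpoly F[n]}) (a1 a2 a3 b1 b2 : F) :
    a3 = 1 + a2 - 2 * b2 -> a3 * b1 = b1 + b2 * a1 ->
    (p - b1 *: q) + a2 *: p - b2 *: (2 *: p + a1 *: q) = a3 *: (p - b1 *: q).
  move=> e1 e2; rewrite scalerBr [a3 *: (b1 *: q)]scalerA e2 e1.
  rewrite [b2 *: _]scalerDr !scalerA !scalerDl scale1r scaleNr opprD !addrA.
  rewrite [b2 * 2]mulrC -!addrA; congr (_ + _); rewrite addrCA; congr (_ + _).
  by rewrite opprD addrCA.
have pole_coefS k : pole_coef k.+2 = 1 + pole_coef k.+1 - 2 * rec_coef k.+1.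
  have := rec_coef_den k; have := pole_coef_den k => H1 H2.
  rewrite /rec_coef /pole_coef -!(natr1 k.+1); move: H1 H2.
  move: (k.+1%:R) => u H1 H2.
  have H3 : 2 * (u + 1) + n%:R - 4 != 0 by move: H2; congr (_ != _); ring.
  by field; rewrite H2 H1.
have pole_rec_coef k :
    pole_coef k.+3 * rec_coef k.+1 = rec_coef k.+1 + rec_coef k.+2 * pole_coef k.+1.
  have := rec_coef_den k; have := pole_coef_den k; have := rec_coef_den k.+1 => H1 H2 H3.
  rewrite pole_coefS /rec_coef /pole_coef -!(natr1 k.+1); move: H1 H2 H3.
  rewrite -!(natr1 k.+1); move: (k.+1%:R) => u H1 H2 H3.
  have H4 : 2 * (u + 1) + n%:R - 4 != 0 by move: H3; congr (_ != _); ring.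
  by field; apply/and3P; split.
elim: i => [|i [IH0 IH1]]; split=> //.
  have D0 : dirder x (zonal x 0) = 0.
    by rewrite /dirder big1 // => i _ /=; rewrite -mpolyC1 mderivC scaler0.
  rewrite zonalSS dirderB dirderZ !dirderM D1 dirder_linform xx zonal1.
  rewrite D0 dirder_sqnorm mulr0 addr0 /= mul1r mulr1 -scalerAr mulr1.
  rewrite scalerA -scaleNr -{1}[linform x]scale1r -!scalerDl; congr (_ *: _).
  by rewrite pole_coefS; ring.
rewrite (zonalSS _ i.+1) dirderB dirderZ !dirderM IH0 IH1 dirder_linform xx.
rewrite dirder_sqnorm mul1r -!scalerAr -scalerAl.
by rewrite (zonalSS _ i); apply: alg.
Qed.

(** In the recurrence, the linear factor contributes 2 [pole_coef i.+1] times [zonal x i] and the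
    factor [sqnorm] contributes (2n + 4i) times it; [rec_coef i.+1] is the ratio that cancels
    them. *)
Lemma laplacian_zonal x i : dotp x x = 1 -> laplacian (zonal x i) = 0.
Proof.
move=> xx.
suff: laplacian (zonal x i) = 0 /\ laplacian (zonal x i.+1) = 0 by case.
have L0 : laplacian (zonal x 0) = 0.
  by rewrite /laplacian big1 // => k _ /=; rewrite -mpolyC1 mderivC mderiv0.
elim: i => [|i [IH0 IH1]]; split=> //.
  rewrite zonal1 /laplacian big1 // => k _.
  by rewrite mderiv_linform mderivC.
rewrite zonalSS laplacianB laplacianZ laplacian_linform laplacian_sqnorm.
rewrite IH0 IH1 !mulr0 !addr0 (dirder_zonal _ xx) euler_zonal !scalerA.
rewrite -scalerDl scalerA -scalerBl.
suff -> : 2 * pole_coef i.+1 - rec_coef i.+1 * (2 * n%:R + 4 * i%:R) = 0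
  by rewrite scale0r.
have H := rec_coef_den i; rewrite /rec_coef -(natr1 i).
by move: H; rewrite -(natr1 i) => H; field.
Qed.

(** * The Fischer product and its reproducing property *)

Definition mfact (m : 'X_{1..n}) : nat := \prod_(i < n) (m i)`!.

(** Multiplication by a variable is adjoint to differentiation for this product. The cutoff [k] on
    degrees makes the index type finite, and each adjunction lowers it by one. *)
Definition fischer (k : nat) p q : F :=
  \sum_(m : 'X_{1..n < k}) (mfact m)%:R * (p@_m * q@_m).

Lemma fischerC k p q : fischer k p q = fischer k q p.
Proof. by apply: eq_bigr => m _; rewrite [p@__ * _]mulrC. Qed.

Lemma fischer_sumZl (I : Type) (r : seq I) (c : I -> F)
    (f : I -> {mpoly F[n]}) k q :
  fischer k (\sum_(i <- r) c i *: f i) q = \sum_(i <- r) c i * fischer k (f i) q.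
Proof.
rewrite /fischer; under [RHS]eq_bigr do rewrite mulr_sumr.
rewrite exchange_big; apply: eq_bigr => m _ /=.
rewrite raddf_sum mulr_suml mulr_sumr; apply: eq_bigr => i _ /=.
by rewrite mcoeffZ -mulrA mulrCA.
Qed.

Lemma fischer_suml (I : Type) (r : seq I) (f : I -> {mpoly F[n]}) k q :
  fischer k (\sum_(i <- r) f i) q = \sum_(i <- r) fischer k (f i) q.
Proof.
have := fischer_sumZl r (fun=> 1) f k q.
by under eq_bigr do rewrite scale1r; under [RHS]eq_bigr do rewrite mul1r.
Qed.

Lemma fischerBl k p p' q : fischer k (p - p') q = fischer k p q - fischer k p' q.
Proof.
rewrite /fischer -sumrB; apply: eq_bigr => m _.
by rewrite mcoeffB mulrBl mulrBr.
Qed.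

Lemma fischerZl k c p q : fischer k (c *: p) q = c * fischer k p q.
Proof.
by rewrite /fischer mulr_sumr; apply: eq_bigr => m _; rewrite mcoeffZ -mulrA mulrCA.
Qed.

Lemma mfactU i (m : 'X_{1..n}) : mfact (m + U_(i)) = ((m i).+1 * mfact m)%N.
Proof.
rewrite /mfact (bigD1 i) //= [in RHS](bigD1 i) //= mulnA; congr (_ * _)%N.
  by rewrite mnmDE mnm1E eqxx addn1 factS.
by apply: eq_bigr => j ji; rewrite mnmDE mnm1E eq_sym (negbTE ji) addn0.
Qed.

Lemma mcoeff_mulXU i p (m : 'X_{1..n}) :
  ('X_i * p)@_m = if (0 < m i)%N then p@_(m - U_(i)) else 0.
Proof.
case: ifPn => [m_gt0|].
  have le_m : (U_(i) <= m)%MM by rewrite lep1mP -lt0n.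
  by rewrite mulrC -{1}(submK le_m) addmC mcoeffMX.
rewrite -eqn0Ngt => /eqP m0; apply/eqP; rewrite mcoeff_eq0 mulrC.
rewrite (perm_mem (msuppMX p _)); apply/negP => /mapP[m' _ mE].
by move: m0; rewrite mE mnmDE mnm1E eqxx.
Qed.

Lemma fischer_mulXl k i p q :
  fischer k.+1 ('X_i * p) q = fischer k p q^`M(i).
Proof.
rewrite /fischer (bigID (fun m : 'X_{1..n < k.+1} => 0 < m i)%N) /=.
rewrite [X in _ + X]big1 ?addr0; last first.
  by move=> m m0; rewrite mcoeff_mulXU (negbTE m0) mul0r mulr0.
have bm (m : 'X_{1..n < k}) : (mdeg (m + U_(i))%MM < k.+1)%N.
  by rewrite mdegD mdeg1 addn1 ltnS bmdeg.
have bm' (m : 'X_{1..n < k.+1}) : (0 < m i)%N ->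
    (mdeg (m - U_(i))%MM < k)%N /\ (m - U_(i) + U_(i))%MM = m.
  move=> m_gt0; have le_m : (U_(i) <= m)%MM by rewrite lep1mP -lt0n.
  split; last by rewrite submK.
  by have := bmdeg m; rewrite -{1}(submK le_m) mdegD mdeg1 addn1.
(* The empty range is split off because [down] needs the default element [bm0]. *)
case: k bm bm' => [|k] bm bm'.
  rewrite [RHS]big1; last by move=> m; have := bmdeg m; rewrite ltn0.
  by rewrite big1 // => m /bm'[]; rewrite ltn0.
pose up m := BMultinom (bm m).
pose down (m : 'X_{1..n < k.+2}) : 'X_{1..n < k.+1} := insubd bm0 (m - U_(i))%MM.
rewrite (reindex_onto up down); last first.
  move=> m m_gt0; have [lt_k mE] := bm' m m_gt0.
  by apply: val_inj; rewrite /= insubdK.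
have addK m : ((m : 'X_{1..n < k.+1}) + U_(i) - U_(i))%MM = m.
  by apply/mnmP => j; rewrite mnmBE mnmDE addnK.
apply: eq_big => [m|m _] /=.
  rewrite mnmDE mnm1E eqxx addn1 /=; apply/eqP/val_inj.
  by rewrite /= /down /= addK insubdK // -topredE /= bmdeg.
rewrite mcoeff_mulXU mnmDE mnm1E eqxx addn1 /= addK mcoeff_mderiv mfactU.
by rewrite natrM -mulr_natl; move: (p@_m) (q@_ _) => u v; ring.
Qed.

Lemma fischer_linform k x p q :
  fischer k.+1 (linform x * p) q = fischer k p (dirder x q).
Proof.
rewrite mulr_suml; under eq_bigr do rewrite -scalerAl.
rewrite fischer_sumZl fischerC /dirder fischer_sumZl.
by apply: eq_bigr => i _; rewrite fischer_mulXl fischerC.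
Qed.

Lemma fischer_sqnorm k p q :
  fischer k.+2 (sqnorm * p) q = fischer k p (laplacian q).
Proof.
rewrite mulr_suml fischer_suml [RHS]fischerC fischer_suml.
by apply: eq_bigr => i _; rewrite expr2 -mulrA !fischer_mulXl fischerC.
Qed.

Lemma dirder_exp x y i :
  dirder x (linform y ^+ i.+1) = (i.+1%:R * dotp x y) *: linform y ^+ i.
Proof.
elim: i => [|i IH].
  by rewrite expr1 expr0 dirder_linform mul1r alg_mpolyC.
rewrite exprS dirderM IH dirder_linform mul_mpolyC -scalerAr -exprS -scalerDl.
by congr (_ *: _); rewrite -[i.+2%:R]natr1 mulrDl mul1r addrC.
Qed.

Lemma laplacian_exp y i : dotp y y = 1 ->
  laplacian (linform y ^+ i.+2) = (i.+2%:R * i.+1%:R) *: linform y ^+ i.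
Proof.
move=> yy; elim: i => [|i IH].
  rewrite expr2 laplacian_linform dirder_linform yy [laplacian _]big1.
    by rewrite mulr0 addr0 expr0 mulr1.
  by move=> i _; rewrite mderiv_linform mderivC.
rewrite exprS laplacian_linform IH dirder_exp yy mulr1 scalerA -scalerAr -exprS.
rewrite -scalerDl; congr (_ *: _).
by rewrite -[i.+3%:R]natr1 -[i.+2%:R]natr1; ring.
Qed.

(** Moving [linform x] and [sqnorm] to the other side turns the recurrence of [zonal] into that of
    [gegen]. The cutoff is generalised since these moves lower it. *)
Lemma fischer_zonal_exp k x y i : dotp x x = 1 -> dotp y y = 1 -> (i < k)%N ->
  fischer k (zonal x i) (linform y ^+ i) = i`!%:R * gegen i (dotp x y).
Proof.
move=> xx yy.
suff H : forall j, (j <= i)%N -> forall k, (j < k)%N ->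
    fischer k (zonal x j) (linform y ^+ j) = j`!%:R * gegen j (dotp x y).
  exact: H.
elim: i {k} => [|i IH] j le_ji k lt_jk.
  move: le_ji lt_jk; rewrite leqn0 => /eqP-> /=; rewrite expr0 fact0 mulr1.
  case: k => // k _; rewrite /fischer (bigD1 bm0) //= big1.
    by rewrite !mcoeff1 eqxx !mulr1 /mfact big1 ?addr0 // => j' _; rewrite mnm0E.
  move=> m m0; rewrite !mcoeff1.
    suff -> : (bmnm m == 0%MM) = false by rewrite mul0r mulr0.
    exact: negbTE m0.
move: le_ji; rewrite leq_eqVlt => /orP[/eqP jE|]; last by move/IH; exact.
subst j; case: k lt_jk => // k; rewrite ltnS => lt_ik.
case: i IH lt_ik => [|i] IH lt_ik.
  rewrite zonal1 -[linform x]mulr1 fischer_linform dirder_exp fischerC fischerZl.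
  by have := IH 0 isT k lt_ik; rewrite fischerC /= => ->; rewrite subr0; ring.
case: k lt_ik => // k lt_ik.
rewrite zonalSS fischerBl fischer_linform fischerZl fischer_sqnorm.
rewrite dirder_exp (laplacian_exp _ yy) ![fischer _ _ (_ *: _)]fischerC !fischerZl.
rewrite [fischer k.+1 _ _]fischerC [fischer k _ _]fischerC !IH //.
rewrite gegenSS !factS !natrM.
move: (gegen i.+1 _) (gegen i _) (rec_coef _) => u v b; ring.
Qed.

Lemma zonal_split y i : exists g, zonal y i = linform y ^+ i - sqnorm * g.
Proof.
suff: (exists g, zonal y i = linform y ^+ i - sqnorm * g) /\
  (exists g, zonal y i.+1 = linform y ^+ i.+1 - sqnorm * g) by case.
elim: i => [|i [IH0 [g gE]]].
  by split; exists 0; rewrite ?zonal1 mulr0 subr0 ?expr0 ?expr1.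
split; first by exists g.
exists (linform y * g + rec_coef i.+1 *: zonal y i).
by rewrite zonalSS gE mulrBr -exprS mulrCA -addrA -opprD mulrDr -scalerAr.
Qed.

(** By [zonal_split], the second argument is [linform y ^+ i] up to a multiple of [sqnorm]. Such
    multiples are orthogonal to harmonic polynomials, [sqnorm] being adjoint to the Laplacian. *)
Lemma fischer_zonal k x y i : dotp x x = 1 -> dotp y y = 1 -> (i < k)%N ->
  fischer k.+2 (zonal x i) (zonal y i) = i`!%:R * gegen i (dotp x y).
Proof.
move=> xx yy lt_ik; have [g ->] := zonal_split y i.
rewrite fischerC fischerBl fischer_sqnorm laplacian_zonal // fischerC.
rewrite fischer_zonal_exp //; last by rewrite ltnW // ltnW.
by rewrite [X in _ - X]big1 ?subr0 // => m _; rewrite mcoeff0 !mulr0.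
Qed.

End Zonal.

(** * Monomial count and Gram matrix inequalities *)

Lemma card_bmultinom (n k : nat) : (#|{: 'X_{1..n < k.+1}}| <= 'C(n + k, n))%N.
Proof.
rewrite -card_partial_ord_partitions.
have lt_mk (m : 'X_{1..n < k.+1}) i : (m i < k.+1)%N.
  by apply: leq_ltn_trans (bmdeg m); rewrite mdegE (bigD1 i) //= leq_addr.
pose f (m : 'X_{1..n < k.+1}) : n.-tuple 'I_k.+1 :=
  [tuple Ordinal (lt_mk m i) | i < n].
have f_inj : injective f.
  move=> m m' /(congr1 (fun t => tnth t)) fE; apply/val_inj/mnmP => i.
  by move: (congr1 (fun g => val (g i)) fE); rewrite !tnth_mktuple.
rewrite -(card_imset _ f_inj) subset_leq_card //; apply/subsetP => t.
case/imsetP=> m _ ->; rewrite inE big_tuple.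
under eq_bigr do rewrite tnth_mktuple /=.
by rewrite -mdegE -ltnS bmdeg.
Qed.

Section Gram.
Variables (F : realFieldType) (I : finType).

(** Schur's product theorem in explicit form: an entrywise product of Gram matrices has the products
    of features as its features, and summing all entries squares each feature's total. *)
Lemma gram_hadamard (C D : finType) (u : C -> F) (v : D -> F)
    (f : C -> I -> F) (g : D -> I -> F) :
  \sum_a \sum_b (\sum_c u c * (f c a * f c b)) * (\sum_d v d * (g d a * g d b)) =
  \sum_c \sum_d u c * v d * (\sum_a f c a * g d a) ^+ 2.
Proof.
transitivity (\sum_a \sum_b \sum_c \sum_d
    u c * v d * ((f c a * g d a) * (f c b * g d b))).
  apply: eq_bigr => a _; apply: eq_bigr => b _.
  rewrite mulr_suml; apply: eq_bigr => c _; rewrite mulr_sumr.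
  by apply: eq_bigr => d _; ring.
under eq_bigr do rewrite exchange_big /=.
rewrite exchange_big /=; apply: eq_bigr => c _.
under eq_bigr do rewrite exchange_big /=.
rewrite exchange_big /=; apply: eq_bigr => d _.
rewrite expr2 mulr_suml mulr_sumr; apply: eq_bigr => a _.
by rewrite !mulr_sumr.
Qed.

Lemma gram_hadamard_ge0 (C D : finType) (u : C -> F) (v : D -> F)
    (f : C -> I -> F) (g : D -> I -> F) :
  (forall c, 0 <= u c) -> (forall d, 0 <= v d) ->
  0 <= \sum_a \sum_b
    (\sum_c u c * (f c a * f c b)) * (\sum_d v d * (g d a * g d b)).
Proof.
move=> u0 v0; rewrite gram_hadamard sumr_ge0 // => c _; rewrite sumr_ge0 // => d _.
by apply: mulr_ge0; [exact: mulr_ge0 | exact: sqr_ge0].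
Qed.

Lemma sum_sqr_le (C : finType) (z : C -> F) :
  (\sum_c z c) ^+ 2 <= #|C|%:R * \sum_c z c ^+ 2.
Proof.
have : 0 <= \sum_c \sum_d (z c - z d) ^+ 2.
  by apply: sumr_ge0 => c _; apply: sumr_ge0 => d _; rewrite sqr_ge0.
have -> : \sum_c \sum_d (z c - z d) ^+ 2 =
    2 * (#|C|%:R * (\sum_c z c ^+ 2)) - 2 * (\sum_c z c) ^+ 2.
  transitivity (\sum_c \sum_d (z c ^+ 2 + z d ^+ 2 - 2 * (z c * z d))).
    by apply: eq_bigr => c _; apply: eq_bigr => d _; ring.
  under eq_bigr do rewrite big_split big_split /= sumr_const sumrN -!mulr_sumr.
  rewrite !big_split /= sumr_const sumrN -mulr_sumr -mulr_suml sumrMnl.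
  have -> : #|xpredT : pred C| = #|C| by [].
  by rewrite -[_ *+ #|C|]mulr_natl; ring.
lra.
Qed.

(** The matrix has rank at most #|C|. Cauchy-Schwarz over the features bounds the squared trace by
    #|C| times the diagonal terms c = d in [gram_hadamard]; the other terms are nonnegative. *)
Lemma gram_trace_sqr (C : finType) (u : C -> F) (f : C -> I -> F) :
  (forall c, 0 <= u c) ->
  (\sum_a \sum_c u c * (f c a * f c a)) ^+ 2 <=
  #|C|%:R * \sum_a \sum_b (\sum_c u c * (f c a * f c b)) ^+ 2.
Proof.
move=> u0; rewrite exchange_big /=.
under [X in _ <= _ * X]eq_bigr do under eq_bigr do rewrite expr2.
rewrite gram_hadamard (le_trans (sum_sqr_le _)) // ler_wpM2l // ler_sum // => c _.
rewrite (bigD1 c) //= -mulr_sumr.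
have -> : (u c * \sum_a f c a * f c a) ^+ 2 =
  u c * u c * (\sum_a f c a * f c a) ^+ 2 by ring.
rewrite lerDl sumr_ge0 // => d _.
by apply: mulr_ge0; [exact: mulr_ge0 | exact: sqr_ge0].
Qed.
End Gram.

(** * The Kabatiansky-Levenshtein bound on spherical codes *)

Section Code.
Variables (F : realFieldType) (n : nat).
Hypothesis n_ge3 : (3 <= n)%N.

(** The features are monomial coefficients. Keeping [k] independent of [i] lets one index type serve
    all degrees. *)
Lemma gegen_gram (I : finType) (x : I -> 'I_n -> F) k i :
  (forall a, dotp (x a) (x a) = 1) -> (i < k)%N ->
  forall a b, gegen n i (dotp (x a) (x b)) =
    \sum_(m : 'X_{1..n < k.+2}) (mfact m)%:R / i`!%:R *
      ((zonal (x a) i)@_m * (zonal (x b) i)@_m).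
Proof.
move=> x1 lt_ik a b.
have i0 : i`!%:R != 0 :> F by rewrite pnatr_eq0 -lt0n fact_gt0.
apply: (mulfI i0); rewrite -(fischer_zonal n_ge3 (x1 a) (x1 b) lt_ik).
rewrite mulr_sumr; apply: eq_bigr => m _.
by rewrite [RHS]mulrA [_ / _]mulrC mulVKf.
Qed.

(** At i = 0 the predecessor is a dummy, harmless because [rec_coef] vanishes there. *)
Lemma gegen_recl i t : t * gegen n i t = gegen n i.+1 t + rec_coef F n i * gegen n i.-1 t.
Proof.
case: i => [|i]; last by rewrite gegenSS subrK.
by rewrite /= /rec_coef /pole_coef !mul0r addr0 subr0.
Qed.

(** At t = 1 the three-term recurrence collapses to a two-term one with positive factors, which
    gives positivity at 1. *)
Lemma gegen_at1 i :
  (2 * i%:R + n%:R - 2) * gegen n i.+1 (1 : F) = (n%:R + i%:R - 2) * gegen n i (1 : F).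
Proof.
elim: i => [|i IH]; first by rewrite /= subr0; ring.
have H1 := rec_coef_den F n_ge3 i; have H2 := pole_coef_den F n_ge3 i.
have H3 : n%:R + i%:R - 2 != 0 :> F.
  rewrite -natrD -natrB ?pnatr_eq0; lia.
rewrite gegenSS.
have -> : gegen n i (1 : F) = (2 * i%:R + n%:R - 2) / (n%:R + i%:R - 2) * gegen n i.+1 (1 : F).
  by apply: (mulfI H3); rewrite -IH; field.
rewrite /rec_coef /pole_coef -!(natr1 i); move: H1 H2 H3; rewrite -!(natr1 i).
move: (gegen n i.+1 (1 : F)) (i%:R) => P u H1 H2 H3.
have H4 : 2 * u + n%:R - 2 != 0 by move: H2; congr (_ != _); ring.
by field; rewrite ?H1 ?H2 ?H3 ?H4.
Qed.

Lemma gegen_at1_gt0 i : 0 < gegen n i (1 : F).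
Proof.
elim: i => [|i IH]; first exact: ltr01.
have p1 : 0 < n%:R + i%:R - 2 :> F by rewrite subr_gt0 -natrD ltr_nat; lia.
have p2 : 0 < 2 * i%:R + n%:R - 2 :> F.
  by rewrite subr_gt0 -natrM -natrD ltr_nat; lia.
by rewrite -(pmulr_rgt0 _ p2) gegen_at1 mulr_gt0.
Qed.

(** Multiplication by t acts on coefficient sequences as a tridiagonal (Jacobi) operator. *)
Lemma shift_expansion k (f : nat -> F) t : (forall i, (k <= i)%N -> f i = 0) ->
  t * (\sum_(i < k) f i * gegen n i t) =
  \sum_(i < k.+1) ((if (i == 0 :> nat) then 0 else f i.-1) +
    rec_coef F n i.+1 * f i.+1) * gegen n i t.
Proof.
move=> f0; rewrite mulr_sumr.
under eq_bigr do rewrite mulrCA gegen_recl mulrDr.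
under [RHS]eq_bigr do rewrite mulrDl.
rewrite !big_split /=; congr (_ + _).
  by rewrite big_ord_recl /= mul0r add0r.
rewrite big_ord_recr /= f0 // mulr0 mul0r addr0.
case: k f0 => [|k] f0; first by rewrite !big_ord0.
rewrite big_ord_recl big_ord_recr /= [f k.+1]f0 // mulr0 mul0r addr0.
rewrite /rec_coef /pole_coef !mul0r mulr0 add0r; apply: eq_bigr => i _ /=.
by rewrite mulrA [f _ * _]mulrC.
Qed.

(** The condition relating [l] and [f] says that [f] is a subeigenvector of the Jacobi operator, so
    (t - l) K(t) has nonnegative coefficients. The features of K are pairs of a degree below [k] and
    a monomial. *)
Theorem spherical_code_bound (I : finType) (x : I -> 'I_n -> F) (s l : F)
    (k : nat) (f : nat -> F) :
  (forall a, dotp (x a) (x a) = 1) ->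
  (forall a b, a != b -> dotp (x a) (x b) <= s) ->
  (forall i, 0 <= f i) -> (forall i, (k <= i)%N -> f i = 0) ->
  (exists2 i, (i < k)%N & 0 < f i) ->
  (forall i, l * f i <=
     (if (i == 0 :> nat) then 0 else f i.-1) + rec_coef F n i.+1 * f i.+1) ->
  s < l -> s <= 1 ->
  #|I|%:R * (l - s) <= (1 - s) * (k * #|{: 'X_{1..n < k.+3}}|)%:R.
Proof.
move=> x1 xs f_ge0 f0 [i0 lt_i0 fi0] lf lt_sl s_le1.
pose K t := \sum_(i < k) f i * gegen n i t.
pose e i := (if (i == 0 :> nat) then 0 else f i.-1) +
  rec_coef F n i.+1 * f i.+1 - l * f i.
have e_ge0 i : 0 <= e i by rewrite subr_ge0.
have KE t : (t - l) * K t = \sum_(i < k.+1) e i * gegen n i t.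
  rewrite mulrBl shift_expansion // mulr_sumr.
  have -> : \sum_(i < k) l * (f i * gegen n i t) =
      \sum_(i < k.+1) l * (f i * gegen n i t).
    by rewrite big_ord_recr /= f0 // mul0r mulr0 addr0.
  by rewrite -sumrB; apply: eq_bigr => i _; rewrite mulrA -mulrBl.
pose T := 'X_{1..n < k.+3}.
pose C := ('I_k * T)%type; pose D := ('I_k.+1 * T)%type.
pose phi k' (c : 'I_k' * T) a := (zonal (x a) c.1)@_(c.2).
pose wt k' (g : nat -> F) (c : 'I_k' * T) := g c.1 * ((mfact c.2)%:R / (c.1)`!%:R).
have wt_ge0 k' g c : (forall i, 0 <= g i) -> 0 <= @wt k' g c.
  by move=> g0; rewrite mulr_ge0 // divr_ge0.
have sumE k' (g : nat -> F) a b : (k' <= k.+1)%N ->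
    \sum_(i < k') g i * gegen n i (dotp (x a) (x b)) =
    \sum_c wt k' g c * (phi k' c a * phi k' c b).
  move=> le_k'; rewrite -(pair_big xpredT xpredT
    (fun i m => wt k' g (i, m) * (phi k' (i, m) a * phi k' (i, m) b))) /=.
  apply: eq_bigr => i _.
  rewrite (gegen_gram (k := k.+1)) ?(leq_trans (ltn_ord i)) // mulr_sumr.
  by apply: eq_bigr => m _; rewrite mulrA.
pose t a b := dotp (x a) (x b).
have K1_gt0 : 0 < K 1.
  rewrite /K (bigD1 (Ordinal lt_i0)) //= ltr_wpDr ?mulr_gt0 ?gegen_at1_gt0 //.
  by apply: sumr_ge0 => i _; rewrite mulr_ge0 // ltW ?gegen_at1_gt0.
(* Schur's theorem for the two positive kernels (t - l) K and K. *)
have EK : 0 <= \sum_a \sum_b ((t a b - l) * K (t a b)) * K (t a b).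
  under eq_bigr do under eq_bigr do
    rewrite KE /K (sumE k.+1) // (sumE k) //.
  by apply: gram_hadamard_ge0 => c; apply: wt_ge0.
have KK : (#|I|%:R * K 1) ^+ 2 <=
    (k * #|{: T}|)%:R * \sum_a \sum_b K (t a b) ^+ 2.
  have -> : #|I|%:R * K 1 = \sum_a K (t a a).
    by under eq_bigr do rewrite /t x1; rewrite sumr_const mulr_natl.
  rewrite /K; under eq_bigr do rewrite (sumE k) //.
  under [X in _ <= _ * X]eq_bigr do under eq_bigr do rewrite (sumE k) //.
  apply: le_trans (gram_trace_sqr _ _) _; first by move=> c; apply: wt_ge0.
  by rewrite card_prod card_ord.
(* Only the diagonal, where t = 1, contributes positively. *)
have up : \sum_a \sum_b (t a b - s) * K (t a b) ^+ 2 <=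
    #|I|%:R * ((1 - s) * K 1 ^+ 2).
  rewrite mulr_natl -sumr_const; apply: ler_sum => a _.
  rewrite (bigD1 a) //= {1 2}/t x1 gerDl; apply: sumr_le0 => b ba.
  by rewrite mulr_le0_ge0 ?sqr_ge0 // subr_le0 xs // eq_sym.
have split : \sum_a \sum_b (t a b - s) * K (t a b) ^+ 2 =
    \sum_a \sum_b ((t a b - l) * K (t a b)) * K (t a b) +
    (l - s) * \sum_a \sum_b K (t a b) ^+ 2.
  rewrite mulr_sumr -big_split; apply: eq_bigr => a _ /=.
  rewrite mulr_sumr -big_split; apply: eq_bigr => b _ /=; ring.
set S := \sum_a \sum_b K (t a b) ^+ 2 in KK split.
case: (posnP #|I|) => [->|I_gt0]; first by rewrite mul0r mulr_ge0 ?subr_ge0.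
have I0 : 0 < #|I|%:R :> F by rewrite ltr0n.
have key : (l - s) * (#|I|%:R * K 1) ^+ 2 <=
    (k * #|{: T}|)%:R * (#|I|%:R * ((1 - s) * K 1 ^+ 2)).
  apply: le_trans (ler_wpM2l _ KK) _; first by rewrite subr_ge0 ltW.
  rewrite mulrCA ler_wpM2l //; apply: le_trans up.
  by rewrite split lerDr.
have M0 : 0 < #|I|%:R * K 1 ^+ 2 by rewrite mulr_gt0 ?exprn_gt0.
rewrite -(ler_pM2r M0); move: key; congr (_ <= _); ring.
Qed.
End Code.

(** * Explicit coefficients and numerical estimates for the kissing problem *)

Section Numeric.
Variable F : realFieldType.

Lemma rec_coef_ge0 (n i : nat) : (3 <= n)%N -> 0 <= rec_coef F n i.+1.
Proof.
move=> n3; have nF : 3 <= n%:R :> F by rewrite ler_nat.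
have iF : 0 <= i%:R :> F by [].
rewrite /rec_coef /pole_coef -natr1.
by rewrite !divr_ge0 ?mulr_ge0 //; lra.
Qed.

(** With q = p + 1 and i = 2q + r, clearing denominators leaves a polynomial in p, r >= 0 whose
    coefficients are all nonnegative. *)
Lemma rec_coef_lower (q i : nat) : (0 < q)%N -> (2 * q <= i)%N ->
  (253 / 1000) ^+ 2 <= rec_coef F (25 * q) i.
Proof.
move=> q0 le_qi; have [p qE] : exists p, q = p.+1 by exists q.-1; rewrite prednK.
rewrite -(subnKC le_qi) qE; move: (i - _)%N => r.
rewrite /rec_coef /pole_coef !natrD !natrM -[p.+1%:R]natr1.
have p0 : 0 <= p%:R :> F by []. have r0 : 0 <= r%:R :> F by [].
move: (p%:R) (r%:R) p0 r0 => {q0 le_qi qE}p {}r p0 r0.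
have d1 : 0 < 2 * (2 * (p + 1) + r) + 25 * (p + 1) - 4 :> F by lra.
have d2 : 0 < 2 * (2 * (p + 1) + r) + 25 * (p + 1) - 2 :> F by lra.
rewrite ler_pdivlMr // ler_pdivlMr //.
have pr : 0 <= p * r by exact: mulr_ge0.
have pp : 0 <= p * p by exact: mulr_ge0.
have rr : 0 <= r * r by exact: mulr_ge0.
nra.
Qed.

(* A parabola times a geometric factor; the truncated subtractions make it vanish
   outside 2q < i < 2q + L.  In dimension 25q, [rec_coef] at i = 2q tends to 54/841,
   whose root is just above 253/1000.  The ratio 2/25 lies just above
   (2 / sqrt 3 - 1) / 2 = 0.0774, from which on 2 sqrt(rec_coef) exceeds 1/2. *)
Definition window (L q i : nat) : F :=
  (1000 / 253) ^+ (i - 2 * q) * ((i - 2 * q) * (L - (i - 2 * q)))%N%:R.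

(** Where [window] vanishes, the right side is merely nonnegative. Elsewhere the geometric factor
    1000/253 offsets the bound (253/1000)^2 on [rec_coef], so both neighbours carry equal weight and
    only the parabola matters. *)
Lemma window_subeigen (q i : nat) : (0 < q)%N ->
  1001 / 2000 * window 100 q i <=
    (if (i == 0 :> nat) then 0 else window 100 q i.-1) +
    rec_coef F (25 * q) i.+1 * window 100 q i.+1.
Proof.
move=> q0; have n3 : (3 <= 25 * q)%N by lia.
have w0 j : 0 <= window 100 q j by rewrite /window mulr_ge0 ?exprn_ge0 //; lra.
have triv : window 100 q i = 0 -> 1001 / 2000 * window 100 q i <=
    (if (i == 0 :> nat) then 0 else window 100 q i.-1) +
    rec_coef F (25 * q) i.+1 * window 100 q i.+1.
  move=> ->; rewrite mulr0; apply: addr_ge0; first by case: ifP.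
  by apply: mulr_ge0 => //; apply: rec_coef_ge0.
case: (leqP i (2 * q)) => [le_iq|lt_qi].
  apply: triv; rewrite /window; have -> : (i - 2 * q = 0)%N by lia.
  by rewrite mul0n mulr0n mulr0.
case: (leqP 100 (i - 2 * q)) => [le_L|lt_L].
  apply: triv; rewrite /window; have -> : (100 - (i - 2 * q) = 0)%N by lia.
  by rewrite muln0 mulr0n mulr0.
rewrite ifF; last by apply/negbTE; lia.
have gbi := @rec_coef_lower q i.+1 q0 ltac:(lia).
apply: (@le_trans _ _ (window 100 q i.-1 + (253 / 1000) ^+ 2 * window 100 q i.+1)); last first.
  by rewrite lerD2l ler_wpM2r.
have [j jE] : exists j, (i - 2 * q = j.+1)%N by exists (i - 2 * q).-1; lia.
rewrite /window jE.
have -> : (i.-1 - 2 * q = j)%N by lia.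
have -> : (i.+1 - 2 * q = j.+2)%N by lia.
have lt_j : (j < 99)%N by lia.
rewrite !natrM !natrB; try lia.
rewrite -[j.+2%:R]natr1 -[j.+1%:R]natr1.
rewrite [_ ^+ j.+2]exprS [_ ^+ j.+1]exprS.
have j1 : j%:R <= 98 :> F by rewrite ler_nat.
have j0 : 0 <= j%:R :> F by [].
have C0 : 0 <= (1000 / 253) ^+ j :> F by rewrite exprn_ge0 //; lra.
move: (_ ^+ j) (j%:R) C0 j0 j1 => C u C0 u0 u1.
(* With g(m) = m (100 - m), the neighbours of u + 1 sum to 2 g(u + 1) - 2, so the claim is (2 -
   1001/506) g(u + 1) >= 2, that is g(u + 1) >= 92; here g(u + 1) >= 99. *)
have key : 0 <= u * (100 - u) + (u + 1 + 1) * (100 - (u + 1 + 1)) -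
    1001 / 2000 * (1000 / 253) * ((u + 1) * (100 - (u + 1))).
  nra.
have := mulr_ge0 C0 key.
lra.
Qed.

(** Raising N to N + 1 multiplies the binomial by (N + 1) / (N + 1 - 25q), at most 27/2 once N >=
    27q. This turns the bounded excess degree into a constant factor. *)
Lemma binomial_growth (q j : nat) :
  'C(27 * q + j, 25 * q)%:R <= (27 / 2) ^+ j * 'C(27 * q, 25 * q)%:R :> F.
Proof.
elim: j => [|j IH]; first by rewrite addn0 expr0 mul1r.
rewrite addnS exprS -mulrA.
set N := (27 * q + j)%N in IH *.
have H : ('C(N.+1, 25 * q) * (N.+1 - 25 * q) = N.+1 * 'C(N, 25 * q))%N.
  by rewrite mulnC mul_bin_down.
have H' : 'C(N.+1, 25 * q)%:R * (N.+1 - 25 * q)%:R = N.+1%:R * 'C(N, 25 * q)%:R :> F.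
  by rewrite -!natrM H.
have p0 : 0 < (N.+1 - 25 * q)%:R :> F by rewrite ltr0n /N; lia.
rewrite -(ler_pM2r p0) H'.
apply: (@le_trans _ _ (27 / 2 * (N.+1 - 25 * q)%:R * 'C(N, 25 * q)%:R)); last first.
  by rewrite mulrAC ler_wpM2r // ler_wpM2l //; lra.
rewrite ler_wpM2r // mulrAC ler_pdivlMr // -!natrM ler_nat /N; lia.
Qed.

(** A single term of the expansion of (2/27 + 25/27)^(27q) = 1 is at most 1. *)
Lemma binomial_entropy (q : nat) :
  'C(27 * q, 25 * q)%:R <= ((27 / 2) ^+ 2 * (27 / 25) ^+ 25) ^+ q :> F.
Proof.
have h : 0 < ((2 / 27) ^+ 2 * (25 / 27) ^+ 25) ^+ q :> F.
  by apply: exprn_gt0; apply: mulr_gt0; apply: exprn_gt0; lra.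
rewrite -(ler_pM2r h) -exprMn.
have -> : (27 / 2) ^+ 2 * (27 / 25) ^+ 25 * ((2 / 27) ^+ 2 * (25 / 27) ^+ 25) = 1 :> F.
  rewrite mulrACA -!exprMn.
  have -> : 27 / 2 * (2 / 27) = 1 :> F by field.
  have -> : 27 / 25 * (25 / 27) = 1 :> F by field.
  by rewrite !expr1n mulr1.
rewrite expr1n.
apply: (@le_trans _ _ ((2 / 27 + 25 / 27) ^+ (27 * q))); last first.
  have -> : 2 / 27 + 25 / 27 = 1 :> F by field.
  by rewrite expr1n.
rewrite exprDn.
have lt_q : (25 * q < (27 * q).+1)%N by lia.
rewrite (bigD1 (Ordinal lt_q)) //= -[X in _ <= X + _]mulr_natl exprMn -!exprM.
have -> : (27 * q - 25 * q = 2 * q)%N by lia.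
rewrite lerDl sumr_ge0 // => i _.
rewrite mulrn_wge0 // mulr_ge0 // exprn_ge0 //; lra.
Qed.

(** The spare factor 51/50 absorbs the linear factor [k] through [linear_le_exp]. Comparing fifth
    powers keeps the numbers small. *)
Lemma base_le : 51 / 50 * ((27 / 2) ^+ 2 * (27 / 25) ^+ 25) <= (4 / 3) ^+ 25 :> F.
Proof.
have h1 : (27 / 25) ^+ 5 <= 147 / 100 :> F by lra.
have h2 : 42 / 10 <= (4 / 3) ^+ 5 :> F by lra.
have -> : (27 / 25) ^+ 25 = ((27 / 25) ^+ 5) ^+ 5 :> F by rewrite -exprM.
have -> : (4 / 3) ^+ 25 = ((4 / 3) ^+ 5) ^+ 5 :> F by rewrite -exprM.
apply: (@le_trans _ _ ((42 / 10) ^+ 5)); last first.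
  by apply: lerXn2r => //; rewrite nnegrE; lra.
apply: (@le_trans _ _ (51 / 50 * ((27 / 2) ^+ 2 * (147 / 100) ^+ 5))); last by lra.
rewrite ler_wpM2l ?ler_wpM2l //; lra.
Qed.

Lemma linear_le_exp (q : nat) : (2 * q + 100)%:R <= 100 * (51 / 50) ^+ q :> F.
Proof.
elim: q => [|q IH]; first by rewrite expr0 mulr1.
rewrite exprS mulrCA; apply: le_trans (ler_wpM2l _ IH); last by lra.
rewrite mulnS addnAC natrD [in leRHS]natrD natrM.
have : 0 <= q%:R :> F by []. lra.
Qed.

(** The gap l - s = 1/2000 and 1 - s = 1/2 give a factor 1000, and [linear_le_exp] gives 100.
    Monomial degrees reach k + 2 = 2q + 102, whence the exponent 102. *)
Lemma kissing_bound_25 (q : nat) (I : finType) (x : I -> 'I_(25 * q) -> F) :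
  (0 < q)%N -> (forall a, dotp (x a) (x a) = 1) ->
  (forall a b, a != b -> dotp (x a) (x b) <= 1 / 2) ->
  #|I|%:R <= 10 ^+ 5 * (27 / 2) ^+ 102 * (4 / 3) ^+ (25 * q) :> F.
Proof.
move=> q0 x1 xs; have n3 : (3 <= 25 * q)%N by lia.
pose k := (2 * q + 100)%N.
have le_I : #|I|%:R * (1001 / 2000 - 1 / 2) <=
    (1 - 1 / 2) * (k * #|{: 'X_{1..(25 * q)%N < k.+3}}|)%:R :> F.
  apply: (spherical_code_bound n3 x1 xs (f := window 100 q)).
  - by move=> i; rewrite /window mulr_ge0 ?exprn_ge0 //; lra.
  - move=> i le_ki; rewrite /window; have -> : (100 - (i - 2 * q) = 0)%N by lia.
    by rewrite muln0 mulr0n mulr0.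
  - exists (2 * q).+1; first by rewrite /k; lia.
    by rewrite /window subSnn mulr_gt0 ?ltr0n // exprn_gt0 //; lra.
  - by move=> i; apply: window_subeigen.
  - lra.
  - lra.
have le_card : #|{: 'X_{1..(25 * q)%N < k.+3}}|%:R <=
    (27 / 2) ^+ 102 * ((27 / 2) ^+ 2 * (27 / 25) ^+ 25) ^+ q :> F.
  apply: (@le_trans _ _ 'C(27 * q + 102, 25 * q)%:R).
    rewrite ler_nat; apply: leq_trans (card_bmultinom _ _) _.
    by have -> : (25 * q + k.+2 = 27 * q + 102)%N by lia.
  apply: le_trans (binomial_growth _ _) _.
  rewrite ler_wpM2l ?binomial_entropy // exprn_ge0 //; lra.
have P102 : 0 <= (27 / 2) ^+ 102 :> F by rewrite exprn_ge0 //; lra.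
move: le_card P102; move: (_ ^+ 102) => P le_card P102.
have le_D : (k * #|{: 'X_{1..(25 * q)%N < k.+3}}|)%:R <= 100 * P * (4 / 3) ^+ (25 * q).
  rewrite natrM exprM; apply: le_trans (ler_pM _ _ (linear_le_exp q) le_card) _ => //.
  rewrite mulrACA -exprMn ler_wpM2l ?mulr_ge0 //.
  apply: lerXn2r; rewrite ?nnegrE ?base_le //.
    by rewrite !mulr_ge0 ?exprn_ge0 //; lra.
  rewrite exprn_ge0 //; lra.
move: (_ ^+ (25 * q)) le_D le_I => Q; lra.
Qed.

(** Padding with zero coordinates up to a multiple of 25 adds at most 25 dimensions, at the cost of
    a factor (4/3)^25. *)
Lemma kissing_bound : exists2 K : F, 0 < K &
  forall (d : nat) (I : finType) (x : I -> 'I_d -> F),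
    (forall a, dotp (x a) (x a) = 1) ->
    (forall a b, a != b -> dotp (x a) (x b) <= 1 / 2) ->
    #|I|%:R <= K * (4 / 3) ^+ d.
Proof.
have C0 : 0 < 10 ^+ 5 * (27 / 2) ^+ 102 :> F by rewrite mulr_gt0 ?exprn_gt0 //; lra.
exists (10 ^+ 5 * (27 / 2) ^+ 102 * (4 / 3) ^+ 25).
  rewrite mulr_gt0 // exprn_gt0 //; lra.
move: (10 ^+ 5 * _) (@kissing_bound_25) C0 => C bound C0.
move=> d I x x1 xs; pose q := (d %/ 25).+1.
have le_dn : (d <= 25 * q)%N by rewrite mulnC ltnW // ltn_ceil.
have le_nd : (25 * q <= 25 + d)%N by rewrite mulnS leq_add2l mulnC leq_trunc_div.
pose y a (i : 'I_(25 * q)) := if insub (val i) is Some i' then x a i' else 0 : F.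
have yE a b : dotp (y a) (y b) = dotp (x a) (x b).
  pose g i := if insub i is Some i' then x a i' * x b i' else 0 : F.
  transitivity (\sum_(i < d) g i); last first.
    by apply: eq_bigr => i _; rewrite /g insubT //= => lt_id; congr (x a _ * x b _); apply: val_inj.
  rewrite (big_ord_widen _ g le_dn) /dotp big_mkcond [in RHS]big_mkcond.
  apply: eq_bigr => i _ /=; rewrite /y /g; case: insubP => [i' -> _|/negbTE->] //.
  by rewrite mul0r.
apply: le_trans (bound q I y _ _ _) _ => //.
- by move=> a; rewrite yE.
- by move=> a b ab; rewrite yE xs.
rewrite -mulrA -exprD; apply: ler_wpM2l; first exact: ltW.
by rewrite ler_weXn2l //; lra.
Qed.
End Numeric.

(** * From separated vectors to spherical codes *)

Definition rvdot (F : realFieldType) (d : nat) (u v : 'rV[F]_d) : F :=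
  dotp (u 0) (v 0).

Lemma rvdotBB (F : realFieldType) d (u v : 'rV[F]_d) :
  rvdot (u - v) (u - v) = rvdot u u + rvdot v v - 2 * rvdot u v.
Proof.
rewrite /rvdot /dotp mulr_sumr -big_split -sumrB; apply: eq_bigr => i _ /=.
rewrite !mxE; ring.
Qed.

Lemma rvdot_gt0 (F : realFieldType) d (u : 'rV[F]_d) : u != 0 -> 0 < rvdot u u.
Proof.
move=> u0; have [i ui] : exists i, u 0 i != 0.
  apply/existsP; apply: contraNT u0 => /existsPn u0; apply/eqP/rowP => i.
  by rewrite mxE; apply/eqP; have := u0 i; rewrite negbK.
rewrite /rvdot /dotp (bigD1 i) //= ltr_wpDr //.
  by apply: sumr_ge0 => k _; rewrite -expr2 sqr_ge0.
by rewrite -expr2 exprn_even_gt0.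
Qed.

Lemma separated_bound (F : rcfType) : exists2 K : F, 0 < K &
  forall (d : nat) (s : seq 'rV[F]_d), uniq s -> 0 \notin s ->
    {in s &, forall u v, u != v -> rvdot u u <= rvdot (u - v) (u - v)} ->
    (size s)%:R <= K * (4 / 3) ^+ d.
Proof.
have [K K0 bound] := kissing_bound F; exists K => // d s us s0 sep.
pose nrm (u : 'rV[F]_d) := Num.sqrt (rvdot u u).
pose x (a : 'I_(size s)) (i : 'I_d) : F := s`_a 0 i / nrm s`_a.
have mem_s (a : 'I_(size s)) : s`_a \in s by exact: mem_nth.
have nz (a : 'I_(size s)) : s`_a != 0 by apply: contraNneq s0 => <-.
have nrm0 (a : 'I_(size s)) : 0 < nrm s`_a by rewrite sqrtr_gt0 rvdot_gt0.
have nrmE (a : 'I_(size s)) : nrm s`_a ^+ 2 = rvdot s`_a s`_a.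
  by rewrite sqr_sqrtr // ltW // rvdot_gt0.
have xE a b : dotp (x a) (x b) = rvdot s`_a s`_b / (nrm s`_a * nrm s`_b).
  rewrite /rvdot /dotp mulr_suml; apply: eq_bigr => i _.
  by rewrite /x invfM mulrACA.
rewrite -[size s]card_ord; apply: (bound d _ x) => [a|a b ab].
  by rewrite xE -nrmE expr2 divff // mulf_neq0 ?lt0r_neq0.
have sab : s`_a != s`_b by rewrite nth_uniq.
have := sep _ _ (mem_s a) (mem_s b) sab.
have := sep _ _ (mem_s b) (mem_s a); rewrite eq_sym => /(_ sab).
rewrite !rvdotBB -!nrmE.
have -> : rvdot s`_b s`_a = rvdot s`_a s`_b.
  by rewrite /rvdot /dotp; apply: eq_bigr => i _; rewrite mulrC.
rewrite xE ler_pdivrMr ?mulr_gt0 //.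
move: (rvdot _ _) (nrm _) (nrm s`_b) (nrm0 a) (nrm0 b) => t p q p0 q0 h1 h2.
(* Separation in both orders gives 2t <= min(p^2, q^2) <= pq, so the normalised inner product is at
   most 1/2. *)
have [le_pq|lt_qp] := leP p q.
  have := ler_wpM2l (ltW p0) le_pq; lra.
have := ler_wpM2r (ltW q0) (ltW lt_qp); lra.
Qed.

(** * Nearest integers and shortest lifts of torus points *)

Lemma distZ_ge0 (x : R) : 0 <= distZ x.
Proof.
have /andP[h1 h2] := floor_itv x.
by rewrite /distZ le_min subr_ge0 h1 /= subr_ge0 -[1]/(1%:~R) -intrD ltW.
Qed.

Lemma distZ_le (x : R) (z : int) : distZ x <= `|x - z%:~R|.
Proof.
have /andP[h1 h2] := floor_itv x; rewrite intrD in h2.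
rewrite /distZ ge_min; have [le_z|lt_z] := leP z (Num.floor x).
  have zF : z%:~R <= (Num.floor x)%:~R :> R by rewrite ler_int.
  by rewrite ger0_norm; first (apply/orP; left); lra.
have zF : (Num.floor x + 1)%:~R <= z%:~R :> R by rewrite ler_int lezD1.
rewrite intrD in zF.
by rewrite ler0_norm; first (apply/orP; right); lra.
Qed.

Definition nearest (x : R) : int :=
  if x - (Num.floor x)%:~R <= (Num.floor x)%:~R + 1 - x then Num.floor x
  else Num.floor x + 1.

Lemma distZ_nearest (x : R) : distZ x = `|x - (nearest x)%:~R|.
Proof.
have /andP[h1 h2] := floor_itv x; rewrite intrD in h2.
rewrite /nearest /distZ; case: leP => _; first by rewrite ger0_norm ?subr_ge0.
by rewrite intrD ler0_norm; lra.
Qed.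

Lemma distZN (x : R) : distZ (- x) = distZ x.
Proof.
have le (y : R) : distZ (- y) <= distZ y.
  rewrite (distZ_nearest y) -normrN opprB addrC -[(nearest y)%:~R]opprK -mulrNz.
  exact: distZ_le.
by apply/eqP; rewrite eq_le le; have := le (- x); rewrite opprK => ->.
Qed.

Lemma trep_periodic d (s t : 'I_d -> R) :
  (forall k, exists z : int, s k = t k + z%:~R) -> trep s = trep t.
Proof.
move=> st; apply/rowP => k; rewrite !mxE; have [z ->] := st k.
by rewrite floorDrz ?intr_int // intrKfloor intrD opprD addrACA subrr addr0.
Qed.

Definition short d (t : 'I_d -> R) : 'rV[R]_d := \row_k (t k - (nearest (t k))%:~R).

Lemma rvdot_short d (t : 'I_d -> R) :
  rvdot (short t) (short t) = \sum_(i < d) distZ (t i) ^+ 2.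
Proof.
apply: eq_bigr => i _; rewrite !mxE distZ_nearest -expr2.
by rewrite -[LHS]real_normK // num_real.
Qed.

Lemma rvdot_short_le d (t : 'I_d -> R) (u : 'rV[R]_d) :
  (forall k, exists z : int, u 0 k = t k - z%:~R) ->
  rvdot (short t) (short t) <= rvdot u u.
Proof.
move=> ut; rewrite rvdot_short; apply: ler_sum => i _.
have [z ->] := ut i; rewrite -expr2 -[leRHS]real_normK ?num_real //.
by rewrite lerXn2r ?nnegrE ?distZ_ge0 ?distZ_le.
Qed.

Lemma tnorm_le_short d (s t : 'I_d -> R) : tnorm s <= tnorm t ->
  rvdot (short s) (short s) <= rvdot (short t) (short t).
Proof.
rewrite /tnorm -!rvdot_short ler_sqrt //.
by rewrite rvdot_short sumr_ge0 // => i _; rewrite sqr_ge0.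
Qed.

(** * Steps along the orbit and their separation *)

Section Steps.
Variables (d : nat) (alpha : 'I_d -> R).

Definition step (n : nat) : 'rV[R]_d := short (w alpha n).
Definition len2 (n : nat) : R := rvdot (step n) (step n).

Lemma tnorm_wdiff a b : tnorm (wdiff alpha a b) = tnorm (w alpha (maxn a b - minn a b)).
Proof.
rewrite /tnorm; congr Num.sqrt; apply: eq_bigr => k _; rewrite /wdiff /w.
rewrite -mulrBr; case: (leqP a b) => le_ab.
  by rewrite -distZN -mulrN opprB natrB.
by rewrite natrB // ltnW.
Qed.

(** The difference of the two lifts is itself a lift of w_(n-m), hence no shorter than the shortest
    one. *)
Lemma len2_le_sub n m : (m <= n)%N ->
  len2 (n - m) <= rvdot (step n - step m) (step n - step m).
Proof.
move=> le_mn; apply: rvdot_short_le => k.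
exists (nearest (w alpha n k) - nearest (w alpha m k)).
by rewrite !mxE /w natrB // intrB; ring.
Qed.

(** For m < n in [T], minimality at n tested against m shows that [step n] is the shorter vector;
    minimality at m tested against n - m, in range by the gap condition, shows that the difference
    is no shorter than [step m]. Zero has no direction and is removed. *)
Lemma size_steps (K : R) (H : nat) (T : seq nat) :
  (forall s : seq 'rV[R]_d, uniq s -> 0 \notin s ->
    {in s &, forall u v, u != v -> rvdot u u <= rvdot (u - v) (u - v)} ->
    (size s)%:R <= K) ->
  {in T, forall n m, (0 < m <= maxn n H)%N -> len2 n <= len2 m} ->
  {in T &, forall n m, (0 < m < n)%N -> (n - m <= maxn m H)%N} ->
  {in T, forall n, 0 < n}%N ->
  (size (rem 0 (undup [seq step n | n <- T])))%:R <= K.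
Proof.
move=> bound minT gapT posT; apply: bound.
- by rewrite rem_uniq ?undup_uniq.
- by rewrite mem_rem_uniq ?undup_uniq // inE eqxx.
have sub u : u \in rem 0 (undup [seq step n | n <- T]) ->
    exists2 n, n \in T & u = step n.
  by move=> /mem_rem; rewrite mem_undup => /mapP.
have le n m : n \in T -> m \in T -> (m < n)%N ->
    len2 n <= len2 m /\ len2 m <= rvdot (step n - step m) (step n - step m).
  move=> nT mT lt_mn; split.
    by apply: minT => //; rewrite posT //= leq_max ltnW.
  apply: le_trans (len2_le_sub (ltnW lt_mn)); apply: minT => //.
  by rewrite subn_gt0 lt_mn gapT // posT.
move=> u v /sub[n nT ->] /sub[m mT ->] nm.
have nm' : n != m by apply: contraNneq nm => ->.
rewrite -/(len2 n); case: (ltngtP m n) nm' => // [lt_mn|lt_nm] _.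
  by have [h1 h2] := le n m nT mT lt_mn; apply: le_trans h2.
have [h1 h2] := le m n mT nT lt_nm; apply: le_trans h2 _.
by rewrite -opprB /rvdot /dotp le_eqVlt; apply/orP; left; apply/eqP;
  apply: eq_bigr => i _; rewrite !mxE mulrNN.
Qed.
End Steps.

(** * Counting the nearest-neighbour differences *)

Theorem theorem3 :
  exists K : R, 0 < K /\
  forall (d N : nat) (alpha : 'I_d -> R) (j : nat -> nat),
    (1 <= d)%N -> (2 <= N)%N ->
    (forall i : nat, (1 <= i <= N)%N ->
       [/\ (1 <= j i <= N)%N, j i != i &
           forall k : nat, (1 <= k <= N)%N -> k != i ->
             tnorm (wdiff alpha i (j i)) <= tnorm (wdiff alpha i k)]) ->
    (cardD alpha j N)%:R <= K * (4 / 3) ^+ d.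
Proof.
have [K K0 bound] := separated_bound R.
(* Two signs, times two halves of at most K (4/3)^d vectors each together with the zero vector. *)
exists (4 * (1 + K)); split; first by lra.
move=> d N alpha j _ N2 jmin.
pose dist a b := (maxn a b - minn a b)%N.
pose T := [seq dist i (j i) | i <- iota 1 N].
pose H := N./2.
have TP n : n \in T -> (0 < n < N)%N /\
    forall m, (0 < m <= maxn n H)%N -> len2 alpha n <= len2 alpha m.
  case/mapP=> i; rewrite mem_iota => iN ->.
  have [jN ji jm] := jmin i ltac:(lia).
  split; first by rewrite /dist; lia.
  move=> m mP.
  (* Index i has partners at every distance up to max(i - 1, N - i). These two numbers sum to N - 1,
     so the larger is at least [H]; it also bounds the distance to [j i]. *)
  have [k [kN ki km]] : exists k, [/\ (1 <= k <= N)%N, k != i & dist i k = m].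
    case: (leqP m (i - 1)) => [le_m|lt_m].
      by exists (i - m)%N; rewrite /dist; split; lia.
    by exists (i + m)%N; move: mP; rewrite /dist /H; split; lia.
  have := jm k kN ki; rewrite !tnorm_wdiff -/(dist i k) km.
  exact: tnorm_le_short.
pose S c := rem 0 (undup [seq step alpha n | n <- T & c n]).
pose lo := [pred n | n <= H]%N.
have sizeS c : c =1 lo \/ c =1 predC lo -> (size (S c))%:R <= K * (4 / 3) ^+ d.
  move=> cE; apply: (size_steps (H := H) (bound d)).
  - by move=> n; rewrite mem_filter => /andP[_ /TP[]].
  (* In the lower half n - m < n <= H. In the upper half n <= N - 1 and m >= H + 1 give n - m <= N -
     H - 2 < H. *)
  - move=> n m; rewrite !mem_filter => /andP[cn /TP[nN _]] /andP[cm /TP[mN _]] mn.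
    move: nN mN cn cm; rewrite /H; case: cE => cE; rewrite !cE /= /H; lia.
  - by move=> n; rewrite mem_filter => /andP[_ /TP[/andP[]]].
pose A := 0 :: S lo ++ S (predC lo).
have memA n : n \in T -> step alpha n \in A.
  move=> nT; rewrite /A inE mem_cat.
  have [//|nz] := eqVneq (step alpha n) 0.
  have inS (c : nat -> bool) : c n -> step alpha n \in S c.
    move=> cn; rewrite mem_rem_uniq ?undup_uniq // inE nz mem_undup.
    by apply: map_f; rewrite mem_filter cn.
  by case: (boolP (lo n)) => [/inS->//|/(inS (predC lo))->]; rewrite orbT.
pose tr (u : 'rV[R]_d) := trep (u 0).
pose B := [seq tr u | u <- A] ++ [seq tr (- u) | u <- A].
(* The difference and the signed shortest lift agree modulo integers, hence have the same canonical
   representative. *)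
have trE a b : trep (wdiff alpha a b) = if (b <= a)%N then
    tr (step alpha (dist a b)) else tr (- step alpha (dist a b)).
  pose z k := nearest (w alpha (dist a b) k).
  case: leqP => le_ab; apply: trep_periodic => k; [exists (z k) | exists (- z k)];
    rewrite !mxE -/(z k) ?mulrNz /wdiff {1 2 3}/w /dist.
    by rewrite (maxn_idPl le_ab) (minn_idPr le_ab) natrB // mulrBr subrK.
  rewrite (maxn_idPr (ltnW le_ab)) (minn_idPl (ltnW le_ab)) natrB ?(ltnW le_ab) //.
  by move: (z k)%:~R => u; ring.
have distC a b : dist a b = dist b a by rewrite /dist maxnC minnC.
have inB n : n \in T -> tr (step alpha n) \in B /\ tr (- step alpha n) \in B.
  move=> /memA nA; rewrite !mem_cat; split; apply/orP; [left|right].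
    exact: map_f nA.
  exact: (map_f (fun u => tr (- u)) nA).
have subB : {subset undup (Dlist alpha j N) <= B}.
  have inBi i : i \in iota 1 N -> _ := fun iN => inB _ (map_f (fun i => dist i (j i)) iN).
  move=> u; rewrite mem_undup mem_cat => /orP[] /mapP[i /inBi[h1 h2] ->]; rewrite trE.
    by case: ifP.
  by rewrite distC; case: ifP.
have : (cardD alpha j N <= size B)%N by apply: uniq_leq_size; rewrite ?undup_uniq.
rewrite -(ler_nat R) => /le_trans; apply.
rewrite size_cat !size_map /= size_cat natrD -natr1 natrD.
have h1 := sizeS lo (or_introl (frefl _)).
have h2 := sizeS (predC lo) (or_intror (frefl _)).
have h3 : 1 <= (4 / 3) ^+ d :> R by rewrite exprn_ege1 //; lra.
lra.
Qed.
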